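(* Let $E=(e_j)_{j\ge 0}$ be the sequence on the unit circle defined by $e_k=\exp\big(i\pi\sum_{j=0}^n a_j2^{-j}\big)$ for $k=\sum_{j=0}^n a_j2^j$, $a_j\in\{0,1\}$, and let $E_k=(e_0,\dots,e_{k-1})$. Then for any $k\ge 1$, $$1\le \frac{\mathbb{L}_{E_k,2}}{\lambda_{E_k,2}(e_k)}=\frac{\mathbb{L}_{E_k,2}}{\sqrt{2^{\sigma_1(k)}-1}}\le 3 .$$
   Context: $\mathcal{U}=\{z\in\mathbb{C}:|z|\le 1\}$ is the closed unit disc. For a sequence $Z=(z_j)_{j\ge0}$ of mutually distinct points of $\mathcal{U}$ and $k\ge1$, $Z_k=(z_0,\dots,z_{k-1})$ and the Lagrange polynomials associated with $Z_k$ are $l_{j,k}(z)=\prod_{0\le i\le k-1,\ i\ne j}\frac{z-z_i}{z_j-z_i}$, $j=0,\dots,k-1$. The quadratic Lebesgue function is $\lambda_{Z_k,2}(z)=\big(\sum_{j=0}^{k-1}|l_{j,k}(z)|^2\big)^{1/2}$, and $\mathbb{L}_{Z_k,2}=\max_{z\in\mathcal{U}}\lambda_{Z_k,2}(z)$. For an integer $k\ge1$, $\sigma_1(k)$ denotes the number of ones in the binary expansion of $k$. *)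

(* Defs.v *)
From mathcomp Require Import all_boot all_order all_algebra.
From mathcomp Require Import complex.
From mathcomp Require Import all_classical all_reals all_analysis.

Set Implicit Arguments.
Unset Strict Implicit.
Unset Printing Implicit Defensive.

Import Order.TTheory GRing.Theory Num.Theory.
Import numFieldNormedType.Exports.
Import Normc.

Local Open Scope classical_set_scope.
Local Open Scope ring_scope.
Local Open Scope complex_scope.

Section Lebesgue.
Variable R : realType.
Implicit Types (Z : nat -> R[i]) (z : R[i]) (k : nat).

(* [normc] is the modulus with values in [R]; the generic norm on [R[i]] takes
   its values in [R[i]] itself: `|z| = (normc z)%:C. *)
Definition closed_unit_disc : set R[i] := [set z | normc z <= 1].

Definition lagrange Z k (j : 'I_k) z : R[i] :=
  \prod_(i < k | i != j) ((z - Z i) / (Z j - Z i)).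

Definition lebesgue2_fun Z k z : R :=
  Num.sqrt (\sum_(j < k) normc (lagrange Z j z) ^+ 2).

(* The supremum is attained: see [lebesgue2_max]. *)
Definition lebesgue2 Z k : R :=
  sup [set lebesgue2_fun Z k z | z in closed_unit_disc].

Let lebesgue2_fun_continuous Z k :
  continuous (fun p : R * R => lebesgue2_fun Z k (p.1 +i* p.2)).
Proof.
have normc_prod (I : Type) (s : seq I) (P : pred I) (F : I -> R[i]) :
    normc (\prod_(i <- s | P i) F i) = \prod_(i <- s | P i) normc (F i).
  by apply: (big_morph (@normc R)); [exact: normcM | exact: normc1].
have cfst : continuous (fun p : R * R => p.1) by move=> p; exact: cvg_fst.
have csnd : continuous (fun p : R * R => p.2) by move=> p; exact: cvg_snd.
pose d z (p : R * R) := Num.sqrt ((p.1 - complex.Re z) ^+ 2 + (p.2 - complex.Im z) ^+ 2).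
have cd z : continuous (d z).
  move=> p; rewrite /d; apply: continuous_comp; last exact: sqrt_continuous.
  apply: cvgD; rewrite -[_ ^+ 2]/(_ * _); apply: cvgM; apply: cvgB;
    by [exact: cfst | exact: csnd | exact: cvg_cst].
have dE z p : d z p = normc (p.1 +i* p.2 - z) by case: z.
have -> : (fun p : R * R => lebesgue2_fun Z k (p.1 +i* p.2)) =
    (fun p => Num.sqrt (\sum_(j < k)
      (\prod_(i < k | i != j) (d (Z i) p * normc (Z j - Z i)^-1)) ^+ 2)).
  apply/funext => p; rewrite /lebesgue2_fun; congr Num.sqrt.
  apply: eq_bigr => j _; rewrite /lagrange normc_prod; congr (_ ^+ 2).
  by apply: eq_bigr => i _; rewrite normcM dE.
move=> p; apply: continuous_comp; last exact: sqrt_continuous.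
apply: continuous_big; first exact: add_continuous.
move=> j _ {}p; apply: continuousM;
  (apply: continuous_big; first exact: mul_continuous);
  by move=> i _ {}p; apply: continuousM; [exact: cd | exact: cvg_cst].
Qed.

Lemma lebesgue2_max Z k :
  exists2 z, closed_unit_disc z &
    lebesgue2 Z k = lebesgue2_fun Z k z /\
    forall w, closed_unit_disc w -> lebesgue2_fun Z k w <= lebesgue2 Z k.
Proof.
pose D := [set p : R * R | p.1 ^+ 2 + p.2 ^+ 2 <= 1].
have DE p : D p <-> closed_unit_disc (p.1 +i* p.2).
  rewrite /D /closed_unit_disc /=; split=> h.
    by rewrite -sqrtr1 ler_sqrt.
  by rewrite -ler_sqrt// sqrtr1.
have D0 : D !=set0 by exists (0, 0); rewrite /D /= expr0n /= addr0.
have cD : compact D.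
  apply: (@subclosed_compact _ D (`[-1, 1] `*` `[-1, 1])).
  - apply: (@preimage_closed _ _ (fun p : R * R => p.1 ^+ 2 + p.2 ^+ 2)
      [set x | x <= 1]); last exact: closed_le.
    move=> p _; apply: cvgD; rewrite -[_ ^+ 2]/(_ * _); apply: cvgM;
      by [exact: cvg_fst | exact: cvg_snd].
  - by apply: compact_setX; exact: segment_compact.
  - move=> p Dp; have aux (x y : R) : x ^+ 2 + y ^+ 2 <= 1 -> -1 <= x <= 1.
      move=> h; rewrite -ler_norml -(@ler_pXn2r _ 2) ?nnegrE//.
      by rewrite expr1n real_normK ?num_real// (le_trans _ h)// lerDl sqr_ge0.
    split; rewrite /= in_itv /=; first exact: aux Dp.
    by apply: (aux _ p.1); rewrite addrC.
have [[a b] /set_mem Dp pmax] := compact_EVT_max D0 cD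
  (continuous_subspaceT (@lebesgue2_fun_continuous Z k)).
have wmax w : closed_unit_disc w ->
    lebesgue2_fun Z k w <= lebesgue2_fun Z k (a +i* b).
  by case: w => x y h; apply: (pmax (x, y)); apply/mem_set/DE.
have supE : lebesgue2 Z k = lebesgue2_fun Z k (a +i* b).
  apply/eqP; rewrite eq_le; apply/andP; split.
    apply: ge_sup; first by exists (lebesgue2_fun Z k (a +i* b)), (a +i* b);
      [exact/(DE (a, b)) | by []].
    by move=> _ [w Uw <-]; exact: wmax.
  apply: ub_le_sup; last by exists (a +i* b) => //; exact/(DE (a, b)).
  by exists (lebesgue2_fun Z k (a +i* b)) => _ [w Uw <-]; exact: wmax.
exists (a +i* b); first exact/(DE (a, b)).
by split=> // w; rewrite supE; exact: wmax.
Qed.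

End Lebesgue.

Section BinaryDigits.

Definition digit (k j : nat) : bool := odd (k %/ 2 ^ j).

(* Digits of [k] of index [j >= k] vanish, since [k < 2 ^ k]. *)
Definition sigma1 (k : nat) : nat := (\sum_(j < k) digit k j)%N.

Lemma digit_small k j : (k < 2 ^ j)%N -> digit k j = false.
Proof. by move=> h; rewrite /digit divn_small. Qed.

Lemma digit_sum n (a : nat -> bool) j :
  digit (\sum_(i < n) a i * 2 ^ i) j = (j < n)%N && a j.
Proof.
elim: n a j => [|n IHn] a j; first by rewrite big_ord0 /digit div0n.
rewrite big_ord_recl expn0 muln1.
under eq_bigr => i _ do rewrite expnS mulnCA.
rewrite -big_distrr /=; case: j => [|j].
  by rewrite /digit expn0 divn1 oddD oddM /= addbF oddb.
rewrite ltnS -(IHn (fun i => a i.+1)) /digit expnS divnMA; congr (odd (_ %/ _)).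
by rewrite addnC mulnC divnMDl// divn_small ?addn0//; case: (a 0).
Qed.

Let digit_sum_big (V : nmodType) (F : nat -> V) n (a : nat -> bool) :
  let k := (\sum_(i < n) a i * 2 ^ i)%N in
  \sum_(j < k) F j *+ digit k j = \sum_(j < n) F j *+ a j.
Proof.
move=> k; have ext m (b : nat -> bool) p : (forall j, (m <= j)%N -> b j = false) ->
    (m <= p)%N -> \sum_(j < m) F j *+ b j = \sum_(j < p) F j *+ b j.
  move=> b0 mp; rewrite (big_ord_widen p (fun j => F j *+ b j))// big_mkcond.
  by apply: eq_bigr => i _; case: ltnP => // /b0 ->.
rewrite (ext k _ (k + n)%N) ?leq_addr//; last first.
  by move=> j kj; rewrite digit_small// (leq_ltn_trans kj)// ltn_expl.
rewrite -(ext n _ (k + n)%N) ?leq_addl//; last first.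
  by move=> j nj; rewrite digit_sum ltnNge nj.
by apply: eq_bigr => i _; rewrite digit_sum ltn_ord.
Qed.

Lemma sigma1E n (a : nat -> bool) :
  sigma1 (\sum_(j < n) a j * 2 ^ j) = (\sum_(j < n) a j)%N.
Proof.
have := digit_sum_big (fun=> 1%N) n a; rewrite /sigma1 /= => h.
transitivity (\sum_(j < n) 1%N *+ a j)%R; last by apply: eq_bigr => j _; case: (a j).
by rewrite -h; apply: eq_bigr => j _; case: (digit _ _).
Qed.

Variable R : realType.

Definition cexp (z : R[i]) : R[i] :=
  (expR (complex.Re z))%:C * (cos (complex.Im z) +i* sin (complex.Im z)).

Definition leja (k : nat) : R[i] :=
  cexp ((pi * \sum_(j < k) (digit k j)%:R * 2 ^- j)*i).

Lemma lejaE n (a : nat -> bool) :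
  leja (\sum_(j < n) a j * 2 ^ j)%N =
  cexp ((pi * \sum_(j < n) (a j)%:R * 2 ^- j)*i).
Proof.
rewrite /leja; congr (cexp (pi * _)*i).
have := digit_sum_big (fun j => 2 ^- j : R) n a => /= h.
under eq_bigr do rewrite mulr_natl.
by rewrite h; apply: eq_bigr => j _; rewrite mulr_natl.
Qed.

End BinaryDigits.

(* Main.v *)
Require Import Defs.
From mathcomp Require Import all_boot all_order all_algebra.
From mathcomp Require Import complex.
From mathcomp Require Import all_classical all_reals all_analysis.
From mathcomp Require Import ring lra zify.

(** Write [e] for the sequence, [w_k] for the monic polynomial vanishing at
    [e_0, ..., e_(k-1)], [lambda_k] for the quadratic Lebesgue function and
    [s] for [sigma1 k]. Everything follows from the binary structure of [e]:
    [e_(2k)] and [e_(2k+1)] are the two square roots of [e_k]. Hence the first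
    [2k] nodes are the square roots of the first [k] ones, and
    [w_(2k)(z) = w_k(z^2)] ([nodal_double]). Likewise each Lagrange polynomial
    for [2k] nodes is one for [k] nodes at [z^2] times [(z + u) / (2u)], where
    [u] is its node ([lagrange_at_double]). The parallelogram identity then gives
    [lambda_(2k)(z)^2 = lambda_k(z^2)^2 (|z|^2 + 1) / 2]
    ([lebesgue2_fun_double]).

    Value at the next point. By the above [lambda_(2k)(e_(2k)) = lambda_k(e_k)].
    At [e_(2k+1) = - e_(2k)] each of the two Lagrange polynomials above a node
    [e_j], [j < k], has the modulus of the one of [e_j] at [e_k], and the last
    one has modulus 1; so
    [lambda_(2k+1)(e_(2k+1))^2 = 2 lambda_k(e_k)^2 + 1]. Thus a digit 0 of the
    index leaves [lambda_k(e_k)^2] alone and a digit 1 acts by [x |-> 2 x + 1],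
    which yields [2^s - 1] ([lebesgue2_fun_next]).

    Upper bound. Passing from [2k] to [2k+1] nodes adds, by Newton's formula, a
    multiple of [w_(2k)(z) / w_(2k)(e_(2k))] to the interpolant. The sequence has
    the Leja property: [w_k] has its largest modulus on the disc, [2^s], at
    [e_k] ([normc_nodal_le], [normc_nodal_next]). Hence that ratio is at most 1
    in modulus, and the triangle inequality gives
    [lambda_(2k+1)(z) <= lambda_(2k)(z) + sqrt (lambda_(2k)(e_(2k))^2 + 1)]
    ([lebesgue2_funS]), where the last term is [sqrt 2 ^ s]. Summing over the
    digits 1 gives a geometric series:
    [lambda_k(z) <= (1 + sqrt 2) (sqrt 2 ^ s - 1)] ([lebesgue2_fun_le]).
    Finally [1 + sqrt 2 <= 3] and [sqrt 2 ^ s - 1 <= sqrt (2^s - 1)]. *)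

Set Implicit Arguments.
Unset Strict Implicit.
Unset Printing Implicit Defensive.

Import Order.TTheory GRing.Theory Num.Theory.
Import Normc.

Local Open Scope ring_scope.
Local Open Scope complex_scope.

(** * Modulus and Euclidean norm *)

Lemma normc_sqr (R : rcfType) (z : R[i]) :
  normc z ^+ 2 = complex.Re z ^+ 2 + complex.Im z ^+ 2.
Proof. by case: z => x y; rewrite sqr_sqrtr// addr_ge0// sqr_ge0. Qed.

Lemma normc_ge0 (R : rcfType) (z : R[i]) : 0 <= normc z.
Proof. by case: z => x y; exact: sqrtr_ge0. Qed.

Lemma normc_eq0 (R : rcfType) (z : R[i]) : (normc z == 0) = (z == 0).
Proof. by apply/eqP/eqP => [/eq0_normc //|->]; exact: normc0. Qed.

Lemma parallelogram (R : rcfType) (z u : R[i]) :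
  normc (z + u) ^+ 2 + normc (z - u) ^+ 2 = 2 * (normc z ^+ 2 + normc u ^+ 2).
Proof. by rewrite !normc_sqr; case: z => x y; case: u => s t /=; ring. Qed.

Definition l2norm (R : rcfType) n (f : nat -> R) : R :=
  Num.sqrt (\sum_(j < n) f j ^+ 2).

Lemma l2norm_ge0 (R : rcfType) n (f : nat -> R) : 0 <= l2norm n f.
Proof. exact: sqrtr_ge0. Qed.

Lemma l2norm_sqr (R : rcfType) n (f : nat -> R) :
  l2norm n f ^+ 2 = \sum_(j < n) f j ^+ 2.
Proof. by rewrite sqr_sqrtr// sumr_ge0// => j _; exact: sqr_ge0. Qed.

Lemma l2normS (R : rcfType) n (f : nat -> R) :
  l2norm n.+1 f = normc (l2norm n f +i* f n).
Proof. by rewrite /normc l2norm_sqr /l2norm big_ord_recr. Qed.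

Lemma l2normZ (R : rcfType) n (t : R) (f : nat -> R) :
  0 <= t -> l2norm n (fun j => t * f j) = t * l2norm n f.
Proof.
move=> t0; rewrite /l2norm; under eq_bigr do rewrite exprMn.
by rewrite -mulr_sumr sqrtrM ?sqr_ge0// sqrtr_sqr ger0_norm.
Qed.

Lemma ler_l2norm (R : rcfType) n (f g : nat -> R) :
  (forall j, (j < n)%N -> 0 <= f j <= g j) -> l2norm n f <= l2norm n g.
Proof.
move=> fg; apply: ler_wsqrtr; apply: ler_sum => j _.
by have /andP[f0 fgj] := fg j (ltn_ord j); rewrite lerXn2r// nnegrE// (le_trans f0).
Qed.

(** Induction on the length: adjoining a coordinate amounts to taking a modulus
    in the plane, so that the planar triangle inequality suffices. *)
Lemma l2normD (R : rcfType) n (f g : nat -> R) :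
  l2norm n (fun j => f j + g j) <= l2norm n f + l2norm n g.
Proof.
elim: n => [|n IHn]; first by rewrite /l2norm !big_ord0 sqrtr0 addr0.
rewrite !l2normS; apply: le_trans (le_normcD _ _).
by rewrite /= ler_wsqrtr// lerD2r lerXn2r// ?nnegrE ?addr_ge0 ?l2norm_ge0.
Qed.

(** * Lagrange interpolation and the adjunction of a node *)

(** The Lagrange polynomial indexed by a natural number, so that the node keeps
    its index when the number of nodes changes. *)
Definition lagrange_at (F : fieldType) (Z : nat -> F) k (j : nat) (z : F) : F :=
  \prod_(i < k | i != j :> nat) ((z - Z i) / (Z j - Z i)).

Definition nodal (F : fieldType) (Z : nat -> F) k (z : F) : F :=
  \prod_(i < k) (z - Z i).

Lemma lebesgue2_funE (R : realType) (Z : nat -> R[i]) k z :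
  lebesgue2_fun Z k z = l2norm k (fun j => normc (lagrange_at Z k j z)).
Proof. by []. Qed.

Lemma lebesgue2_fun_ge0 (R : realType) (Z : nat -> R[i]) k z :
  0 <= lebesgue2_fun Z k z.
Proof. exact: sqrtr_ge0. Qed.

Lemma lagrange_atS (F : fieldType) (Z : nat -> F) k j z : (j < k)%N ->
  lagrange_at Z k.+1 j z = lagrange_at Z k j z * ((z - Z k) / (Z j - Z k)).
Proof.
move=> jk; rewrite /lagrange_at big_mkcond big_ord_recr -big_mkcond /=.
by rewrite gtn_eqF.
Qed.

Lemma lagrange_at_last (F : fieldType) (Z : nat -> F) k z :
  lagrange_at Z k.+1 k z = nodal Z k z / nodal Z k (Z k).
Proof.
rewrite /lagrange_at big_mkcond big_ord_recr /= eqxx mulr1 /nodal -prodf_div.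
by apply: eq_bigr => i _; rewrite ltn_eqF.
Qed.

Lemma nodal_neq0 (F : fieldType) (Z : nat -> F) k :
  injective Z -> nodal Z k (Z k) != 0.
Proof.
move=> injZ; apply/prodf_neq0 => i _; rewrite subr_eq0.
by apply: contraTneq (ltn_ord i) => /injZ <-; rewrite ltnn.
Qed.

(** Newton's form of the interpolant: the new node contributes a multiple of the
    nodal polynomial, which corrects the value there. *)
Lemma lagrange_atS_newton (F : fieldType) (Z : nat -> F) k j z :
  injective Z -> (j < k)%N ->
  lagrange_at Z k.+1 j z = lagrange_at Z k j z -
    lagrange_at Z k j (Z k) * (nodal Z k z / nodal Z k (Z k)).
Proof.
move=> injZ jk; rewrite lagrange_atS//.
have nz x y : x != y -> Z x - Z y != 0.
  by move=> xy; rewrite subr_eq0; apply: contraNneq xy => /injZ ->.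
have jk0 : Z j - Z k != 0 by rewrite nz// ltn_eqF.
pose P x := \prod_(i < k | i != j :> nat) (x - Z i).
have nodalE x : nodal Z k x = (x - Z j) * P x.
  by rewrite /nodal (bigD1 (Ordinal jk)).
have lagrE x : lagrange_at Z k j x = P x / P (Z j) by rewrite /lagrange_at prodf_div.
have Pk : P (Z k) != 0.
  by apply/prodf_neq0 => i _; rewrite nz// gtn_eqF.
have Pj : P (Z j) != 0 by apply/prodf_neq0 => i ij; rewrite nz// eq_sym.
have kj0 : Z k - Z j != 0 by rewrite nz// gtn_eqF.
rewrite !lagrE !nodalE; field.
by rewrite Pk Pj jk0 kj0.
Qed.

(** The first [k] entries come from Newton's form, the last one is the ratio of
    nodal polynomials itself; the triangle inequality in [l2norm] separates the
    old Lebesgue function from the correction. The coefficients of that ratio are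
    the [- lagrange_at Z k j (Z k)] and, for the new node, 1: hence the square
    root. *)
Lemma lebesgue2_funS (R : realType) (Z : nat -> R[i]) k z : injective Z ->
  lebesgue2_fun Z k.+1 z <= lebesgue2_fun Z k z +
    Num.sqrt (lebesgue2_fun Z k (Z k) ^+ 2 + 1) *
      (normc (nodal Z k z) / normc (nodal Z k (Z k))).
Proof.
move=> injZ; rewrite !lebesgue2_funE.
set t := normc (nodal Z k z) / _.
have t0 : 0 <= t by rewrite divr_ge0 ?normc_ge0.
(* The two vectors are indexed by the [k.+1] nodes; the new node has entry 0
   in the old Lebesgue function and entry 1 in the correction. *)
pose f j := if (j < k)%N then normc (lagrange_at Z k j z) else 0.
pose g j := if (j < k)%N then normc (lagrange_at Z k j (Z k)) else 1.
have -> : l2norm k (fun j => normc (lagrange_at Z k j z)) = l2norm k.+1 f.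
  rewrite /l2norm big_ord_recr /= /f ltnn expr0n addr0; congr Num.sqrt.
  by apply: eq_bigr => j _; rewrite ltn_ord.
have -> : Num.sqrt (l2norm k (fun j => normc (lagrange_at Z k j (Z k))) ^+ 2 + 1)
    = l2norm k.+1 g.
  rewrite l2norm_sqr /l2norm big_ord_recr /= /g ltnn expr1n.
  congr (Num.sqrt (_ + _)).
  by apply: eq_bigr => j _; rewrite ltn_ord.
rewrite mulrC -l2normZ//; apply: le_trans (l2normD _ _ _); apply: ler_l2norm => j.
rewrite normc_ge0 ltnS leq_eqVlt /f /g => /predU1P[->|jk].
  by rewrite ltnn add0r mulr1 lagrange_at_last normcM normcV lexx.
rewrite jk lagrange_atS_newton//; apply: le_trans (le_normcD _ _) _.
by rewrite lerD2l normcN !normcM normcV mulrC lexx.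
Qed.

(** * Dyadic structure of the sequence *)

Lemma big_double (T : Type) (idx : T) (op : Monoid.law idx) k (F : nat -> T) :
  \big[op/idx]_(i < k.*2) F i = \big[op/idx]_(i < k) op (F i.*2) (F i.*2.+1).
Proof.
elim: k => [|k IHk]; first by rewrite !big_ord0.
by rewrite doubleS !big_ord_recr /= IHk Monoid.mulmA.
Qed.

Lemma digit0 k : digit k 0 = odd k.
Proof. by rewrite /digit expn0 divn1. Qed.

Lemma digitS (b : bool) k j : digit (b + k.*2)%N j.+1 = digit k j.
Proof.
rewrite /digit expnS divnMA; congr (odd (_ %/ _)).
by case: b; rewrite -muln2; lia.
Qed.

(** Since [k < 2 ^ k], the digits of index at least [k] vanish. This allows one
    to compare sums over the digits of [k] and of [b + k.*2], whose ranges are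
    otherwise unrelated. *)
Lemma big_digit_widen (V : nmodType) (F : nat -> V) k n : (k <= n)%N ->
  \sum_(j < k) F j *+ digit k j = \sum_(j < n) F j *+ digit k j.
Proof.
move=> kn; rewrite (big_ord_widen n (fun j => F j *+ digit k j))// big_mkcond.
apply: eq_bigr => j _; case: ltnP => // kj.
by rewrite digit_small// (leq_ltn_trans kj)// ltn_expl.
Qed.

Lemma big_digit_double (V : nmodType) (F : nat -> V) (b : bool) k :
  \sum_(j < (b + k.*2)%N) F j *+ digit (b + k.*2)%N j =
  F 0 *+ b + \sum_(j < k) F j.+1 *+ digit k j.
Proof.
rewrite (@big_digit_widen _ _ _ (b + k.*2).+1)// big_ord_recl /=.
rewrite digit0 oddD odd_double addbF oddb; congr (_ + _).
rewrite (@big_digit_widen _ (fun j => F j.+1) k (b + k.*2)); last by lia.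
by apply: eq_bigr => j _; rewrite digitS.
Qed.

Lemma sigma1_double (b : bool) k : sigma1 (b + k.*2) = (b + sigma1 k)%N.
Proof.
have E m : sigma1 m = \sum_(j < m) (1 : nat) *+ digit m j.
  by apply: eq_bigr => j _; case: digit.
by rewrite !E (@big_digit_double _ (fun=> 1%N)); case: b.
Qed.

Definition leja_angle (R : realType) k : R :=
  pi * \sum_(j < k) (digit k j)%:R * 2 ^- j.

Lemma leja_polar (R : realType) k :
  leja R k = cos (leja_angle R k) +i* sin (leja_angle R k).
Proof. by rewrite /leja /cexp /= expR0 mul1r. Qed.

(** Prepending a digit halves the weights of the other digits. *)
Lemma leja_angle_double (R : realType) (b : bool) k :
  leja_angle R (b + k.*2) = pi * (b : nat)%:R + leja_angle R k / 2.
Proof.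
have E n : leja_angle R n = pi * \sum_(j < n) (2 ^- j : R) *+ digit n j.
  by congr (_ * _); apply: eq_bigr => j _; rewrite mulr_natl.
rewrite !E (@big_digit_double _ (fun j => 2 ^- j)) expr0 invr1 mulrDr.
rewrite -mulrA mulr_suml; congr (_ + _ * _); apply: eq_bigr => j _.
by rewrite exprS invfM mulrnAl mulrC.
Qed.

Lemma leja_sign (R : realType) (b : bool) k :
  leja R (b + k.*2) = (-1) ^+ b * leja R k.*2.
Proof.
case: b; last by rewrite add0n mul1r.
rewrite !leja_polar -[in RHS](add0n k.*2) (leja_angle_double R false).
rewrite leja_angle_double mulr0 add0r mulr1 addrC cosDpi sinDpi mulN1r.
by apply/eqP; rewrite eq_complex /= !eqxx.
Qed.

Lemma leja_sqr (R : realType) (b : bool) k : leja R (b + k.*2) ^+ 2 = leja R k.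
Proof.
rewrite leja_sign exprMn sqrr_sign mul1r -[in LHS](add0n k.*2) !leja_polar.
rewrite (leja_angle_double R false) mulr0 add0r; set h := leja_angle R k / 2.
have -> : leja_angle R k = h + h by rewrite /h; field.
rewrite cosD sinD expr2; apply/eqP; rewrite eq_complex /=; apply/andP; split=> //.
by rewrite addrC mulrC.
Qed.

Lemma leja_opp (R : realType) k : leja R k.*2.+1 = - leja R k.*2.
Proof. by rewrite (leja_sign R true) mulN1r. Qed.

Lemma normc_leja (R : realType) k : normc (leja R k) = 1.
Proof. by rewrite leja_polar /normc cos2Dsin2 sqrtr1. Qed.

Lemma leja_neq0 (R : realType) k : leja R k != 0.
Proof. by rewrite -normc_eq0 normc_leja oner_neq0. Qed.

(** Induction on the binary expansion, from the leading digit down. *)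
Lemma bool_double_ind (P : nat -> Prop) : P 0%N ->
  (forall (b : bool) k, P k -> P (b + k.*2)%N) -> forall k, P k.
Proof.
move=> P0 PS; elim/ltn_ind => -[//|k] IHk; rewrite -(odd_double_half k.+1).
by apply: PS; apply: IHk; rewrite /= ltnS uphalf_half; lia.
Qed.

(** Equal values have equal squares, hence equal halved indices by induction;
    the two indices with a given half carry opposite nonzero values. *)
Lemma leja_inj (R : realType) : injective (leja R).
Proof.
move=> m n; have [s] := ubnP (m + n); elim: s m n => // s IHs m n ltmn.
rewrite -(odd_double_half m) -(odd_double_half n) => E.
have halves : m./2 = n./2.
  have [mn0|mn0] := posnP (m + n); first by lia.
  apply: IHs; first by lia.
  by rewrite -(leja_sqr _ (odd m) m./2) -(leja_sqr _ (odd n) n./2) E.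
congr (_ + _)%N; last by rewrite halves.
move: E; rewrite halves (leja_sign R (odd m)) (leja_sign R (odd n)).
move=> /(mulIf (leja_neq0 R _)).
have n1 : (-1 == 1 :> R[i]) = false.
  by apply/negbTE; rewrite eq_sym -addr_eq0 -mulr2n pnatr_eq0.
by case: (odd m); case: (odd n) => //= /eqP; rewrite ?n1 // eq_sym n1.
Qed.

(** * Halving the number of nodes *)

Lemma nodal_double (R : realType) k (z : R[i]) :
  nodal (leja R) k.*2 z = nodal (leja R) k (z ^+ 2).
Proof.
rewrite /nodal (big_double _ _ (fun i => z - leja R i)); apply: eq_bigr => i _ /=.
by rewrite leja_opp -(leja_sqr _ false i) add0n; ring.
Qed.

(** The nodes come in pairs of opposite square roots. A pair that does not
    contain [u] contributes [(z ^+ 2 - leja R i) / (u ^+ 2 - leja R i)]; in the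
    pair of [u] only the opposite node [- u] contributes. *)
Lemma lagrange_at_double (R : realType) (b : bool) k j (z : R[i]) : (j < k)%N ->
  let u := leja R (b + j.*2) in
  lagrange_at (leja R) k.*2 (b + j.*2) z =
  lagrange_at (leja R) k j (z ^+ 2) * ((z + u) / (u + u)).
Proof.
move=> jk u; rewrite /lagrange_at big_mkcond.
rewrite (big_double _ _ (fun i => if i != (b + j.*2)%N then
  (z - leja R i) / (leja R (b + j.*2) - leja R i) else 1)) /= -/u.
rewrite (bigD1 (Ordinal jk))//= mulrC; congr (_ * _).
  apply: eq_big => // i ij.
  have [ij0 ij1] : i.*2 != (b + j.*2)%N /\ i.*2.+1 != (b + j.*2)%N.
    by move: ij; rewrite -val_eqE /= => ij; case: (b); lia.
  rewrite ij0 ij1 mulf_div leja_opp.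
  rewrite -(leja_sqr R false i) -(leja_sqr R b j) add0n -/u.
  by congr (_ / _); ring.
have uE : leja R j.*2 = (-1) ^+ b * u.
  by rewrite /u leja_sign mulrA -expr2 sqrr_sign mul1r.
rewrite leja_opp; case: (b) uE => /= ->.
  by rewrite add1n eqxx ltn_eqF//= !mulN1r !opprK mulr1.
by rewrite add0n eqxx gtn_eqF//= !mul1r !opprK.
Qed.

(** The two nodes of a pair share the factor [lagrange_at (leja R) k j (z ^+ 2)]
    and their other factors are [(z + u) / (u + u)] and [(z - u) / (- (u + u))],
    to which the parallelogram identity applies. *)
Lemma lebesgue2_fun_double (R : realType) k (z : R[i]) :
  lebesgue2_fun (leja R) k.*2 z ^+ 2 =
  lebesgue2_fun (leja R) k (z ^+ 2) ^+ 2 * ((normc z ^+ 2 + 1) / 2).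
Proof.
rewrite !lebesgue2_funE !l2norm_sqr.
rewrite (big_double _ _ (fun j => normc (lagrange_at (leja R) k.*2 j z) ^+ 2)).
rewrite mulr_suml; apply: eq_bigr => j _ /=.
have normcuu (u : R[i]) : normc u = 1 -> normc (u + u) = 2.
  by move=> u1; rewrite -mulr2n normcMn u1.
have := lagrange_at_double false z (ltn_ord j); rewrite /= add0n => ->.
have := lagrange_at_double true z (ltn_ord j); rewrite /= add1n => ->.
rewrite !normcM !normcV !normcuu ?normc_leja// !exprMn -mulrDr -mulrDl.
by rewrite leja_opp parallelogram normc_leja; congr (_ * _); field.
Qed.

(** * Values at the next point of the sequence *)

(** For an odd number of nodes the next point is opposite to the last node, so
    that the extra factor has the largest possible modulus, 2. *)
Lemma normc_nodal_next (R : realType) k :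
  normc (nodal (leja R) k (leja R k)) = 2 ^+ sigma1 k.
Proof.
elim/bool_double_ind: k => [|b k IHk].
  by rewrite /nodal /sigma1 !big_ord0 normc1.
rewrite sigma1_double; case: b => /=; rewrite ?add0n ?add1n; last first.
  by have := leja_sqr R false k; rewrite nodal_double -IHk add0n => ->.
rewrite {1}/nodal big_ord_recr normcM -/(nodal _ _ _) nodal_double.
rewrite (leja_sqr R true k) exprS mulrC leja_opp -opprD normcN -IHk; congr (_ * _).
by rewrite -mulr2n normcMn normc_leja.
Qed.

(** Let [u] be the node and [v := leja R k.*2] the last node, so that the next
    point is [- v]. The Lagrange polynomial is the one for [k] nodes at
    [(- v) ^+ 2 = leja R k] times
    [(- v + u) / (u + u) * ((- v - v) / (u - v))], which has modulus 1. *)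
Lemma normc_lagrange_at_next (R : realType) (b : bool) k j : (j < k)%N ->
  normc (lagrange_at (leja R) k.*2.+1 (b + j.*2) (leja R k.*2.+1)) =
  normc (lagrange_at (leja R) k j (leja R k)).
Proof.
move=> jk; rewrite lagrange_atS; last by case: b; lia.
rewrite lagrange_at_double// (leja_sqr R true k) -mulrA normcM leja_opp.
set u := leja R (b + j.*2); set v := leja R k.*2.
have uv0 : normc (u - v) != 0.
  rewrite normc_eq0 subr_eq0; apply/eqP => /leja_inj; case: (b); lia.
rewrite addrC !normcM !normcV -(opprD v v) normcN -!mulr2n !normcMn !normc_leja.
by rewrite [X in _ * X]mulrA divfK ?pnatr_eq0// divff// mulr1.
Qed.

(** A trailing digit 0 leaves the value unchanged. A trailing digit 1 doubles it,
    since each node splits into two with the same modulus, and adds 1 for the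
    last node: its Lagrange polynomial takes the same value 1 at the opposite
    point, being a function of [z ^+ 2]. *)
Lemma lebesgue2_fun_next (R : realType) k :
  lebesgue2_fun (leja R) k (leja R k) ^+ 2 = 2 ^+ sigma1 k - 1.
Proof.
elim/bool_double_ind: k => [|b k IHk].
  by rewrite lebesgue2_funE l2norm_sqr /sigma1 !big_ord0 subrr.
rewrite sigma1_double; case: b; rewrite ?add0n ?add1n; last first.
  rewrite lebesgue2_fun_double (leja_sqr R false k) normc_leja IHk.
  by field.
rewrite (exprS 2) -[X in 2 * X](subrK 1) -IHk.
rewrite !lebesgue2_funE !l2norm_sqr big_ord_recr.
rewrite (big_double _ _
  (fun j => normc (lagrange_at (leja R) k.*2.+1 j (leja R k.*2.+1)) ^+ 2)) /=.
under eq_bigr => j _.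
  have := normc_lagrange_at_next R false (ltn_ord j); rewrite add0n => ->.
  have := normc_lagrange_at_next R true (ltn_ord j); rewrite add1n => ->.
  over.
rewrite lagrange_at_last !nodal_double (leja_sqr R true k).
have := leja_sqr R false k; rewrite add0n => ->.
rewrite divff ?nodal_neq0//; last exact: leja_inj.
by rewrite normc1 big_split /=; ring.
Qed.

(** * The upper bound *)

(** The Leja property: by [normc_nodal_next] the bound is reached at the next
    point. Each binary digit 1 contributes a factor of modulus at most 2. *)
Lemma normc_nodal_le (R : realType) k (z : R[i]) : normc z <= 1 ->
  normc (nodal (leja R) k z) <= 2 ^+ sigma1 k.
Proof.
elim/bool_double_ind: k z => [|b k IHk] z z1.
  by rewrite /nodal /sigma1 !big_ord0 normc1.
have z21 : normc (z ^+ 2) <= 1 by rewrite expr2 normcM mulr_ile1 ?normc_ge0.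
rewrite sigma1_double; case: b => /=; rewrite ?add0n ?add1n; last first.
  by rewrite nodal_double IHk.
rewrite /nodal big_ord_recr normcM -/(nodal (leja R) k.*2 z) nodal_double.
rewrite (exprSr 2); apply: ler_pM; rewrite ?normc_ge0 ?IHk//.
apply: le_trans (le_normcD _ _) _.
by rewrite normcN normc_leja; lra.
Qed.

(** A trailing digit 0 costs nothing, as [(normc z ^+ 2 + 1) / 2 <= 1]; a trailing
    digit 1 after [k] costs at most [Num.sqrt 2 ^+ sigma1 k]. The right-hand side
    is the sum of the geometric progression of the [Num.sqrt 2 ^+ m] for
    [m < sigma1 k], because [(Num.sqrt 2 - 1)^-1 = 1 + Num.sqrt 2]. *)
Lemma lebesgue2_fun_le (R : realType) k (z : R[i]) : normc z <= 1 ->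
  lebesgue2_fun (leja R) k z <=
  (1 + Num.sqrt 2) * (Num.sqrt 2 ^+ sigma1 k - 1).
Proof.
elim/bool_double_ind: k z => [|b k IHk] z z1.
  by rewrite lebesgue2_funE /l2norm /sigma1 !big_ord0 sqrtr0 subrr mulr0.
have z21 : normc (z ^+ 2) <= 1 by rewrite expr2 normcM mulr_ile1 ?normc_ge0.
have even_le : lebesgue2_fun (leja R) k.*2 z <= lebesgue2_fun (leja R) k (z ^+ 2).
  rewrite -(@ler_pXn2r _ 2) ?nnegrE ?lebesgue2_fun_ge0//.
  rewrite lebesgue2_fun_double ler_piMr ?sqr_ge0//.
  have : normc z ^+ 2 <= 1 by rewrite expr_le1 ?normc_ge0.
  lra.
rewrite sigma1_double; case: b; rewrite ?add0n ?add1n; last first.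
  exact: le_trans even_le (IHk _ z21).
apply: le_trans (lebesgue2_funS _ _ (@leja_inj R)) _.
have sig : sigma1 k.*2 = sigma1 k by rewrite -[k.*2]add0n (sigma1_double false).
rewrite lebesgue2_fun_next subrK sig normc_nodal_next sig.
set q : R := Num.sqrt 2 ^+ sigma1 k.
have q0 : 0 <= q by rewrite exprn_ge0 ?sqrtr_ge0.
have -> : Num.sqrt (2 ^+ sigma1 k) = q :> R.
  by rewrite -{1}[2]sqr_sqrtr// -exprM mulnC exprM sqrtr_sqr -/q ger0_norm.
have w1 : normc (nodal (leja R) k.*2 z) / 2 ^+ sigma1 k <= 1.
  by rewrite ler_pdivrMr ?exprn_gt0// mul1r -sig normc_nodal_le.
have s2 : Num.sqrt 2 ^+ 2 = 2 :> R by rewrite sqr_sqrtr.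
apply: le_trans (lerD (le_trans even_le (IHk _ z21)) (ler_piMr q0 w1)) _.
by rewrite exprS -/q; nra.
Qed.

Theorem theorem2p6 (R : realType) (k : nat) (k_ge1 : (1 <= k)%N) :
  [/\ 1 <= lebesgue2 (leja R) k / lebesgue2_fun (leja R) k (leja R k),
      lebesgue2 (leja R) k / lebesgue2_fun (leja R) k (leja R k) =
        lebesgue2 (leja R) k / Num.sqrt (2 ^+ sigma1 k - 1)
    & lebesgue2 (leja R) k / Num.sqrt (2 ^+ sigma1 k - 1) <= 3].
Proof.
have lamE : lebesgue2_fun (leja R) k (leja R k) = Num.sqrt (2 ^+ sigma1 k - 1).
  by rewrite -lebesgue2_fun_next sqrtr_sqr ger0_norm ?lebesgue2_fun_ge0.
have sigma_gt0 : (0 < sigma1 k)%N.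
  elim/bool_double_ind: k k_ge1 {lamE} => // b k IHk; rewrite sigma1_double.
  by case: b => //; rewrite !add0n double_gt0.
have s2 : Num.sqrt 2 ^+ 2 = 2 :> R by rewrite sqr_sqrtr.
have s0 : 0 <= Num.sqrt 2 :> R by exact: sqrtr_ge0.
set q : R := Num.sqrt 2 ^+ sigma1 k.
have q2 : q ^+ 2 = 2 ^+ sigma1 k by rewrite /q -exprM mulnC exprM s2.
have q1 : 1 <= q by rewrite exprn_ege1//; nra.
have lam0 : 0 < Num.sqrt (2 ^+ sigma1 k - 1) :> R.
  by rewrite sqrtr_gt0 subr_gt0 exprn_egt1 -?lt0n// ltr1n.
have [z z1 [LE Lmax]] := lebesgue2_max (leja R) k.
rewrite lamE; split=> //.
  rewrite ler_pdivlMr// mul1r -lamE; apply: Lmax.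
  by change (normc (leja R k) <= 1); rewrite normc_leja.
rewrite ler_pdivrMr// LE; apply: le_trans (lebesgue2_fun_le k z1) _.
rewrite -/q; apply: (@ler_pM _ _ _ (q - 1)) => //; [nra | nra |].
rewrite -(@ler_pXn2r _ 2) ?nnegrE ?sqrtr_ge0// ?subr_ge0//.
by rewrite sqr_sqrtr -q2; nra.
Qed.
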